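(* For every spanning forest $F$ of $G$, every square minor of $B_F$ belongs to $\{0,+1,-1\}$. In particular, if $F$ has $s$ connected components and $S\subseteq N$ has $|S|=s-1$, then $\chi_F(S)\in\{0,+1,-1\}$, and $\chi_F(S)\neq0$ if and only if the quotient edges in $S$ form a spanning tree of $H_F$.
   Context: Network. $G=(V,E)$ is a finite connected simple undirected graph. A spanning forest $F$ of $G$ is an acyclic subgraph with vertex set $V$ (isolated vertices allowed). Matrix conventions. $A[S,T]$ is the submatrix with rows $S$ and columns $T$ in inherited order; $A[:,T]$ keeps all rows; empty determinants equal $1$. Superports. The boundary $M\subseteq V$ is nonempty and partitioned into nonempty superports $M=A_1\sqcup\cdots\sqcup A_p$. Choose a root $r_a\in A_a$ for each $a$; $R=\{r_1,\dots,r_p\}$, $N=M\setminus R$, $q=|N|$, $N=(x_1,\dots,x_q)$ in a fixed order; $r(x)$ is the root of the superport containing $x$. Fix a ground root $g\in R$. In $\mathbb R^{V\setminus\{g\}}$ with standard basis $(e_v)$ and the convention $e_g=0$, let $D$ be the matrix whose columns are $d_x=e_x-e_{r(x)}$, $x\in N$, in the fixed order. Quotient port graph. For a spanning forest $F$ with $s\ge1$ components, let $C_0(F)$ be the component containing $g$ and order the others as $C_1(F),\dots,C_{s-1}(F)$. The quotient port multigraph $H_F$ has the components of $F$ as vertices, and each $x\in N$ gives a directed edge (the quotient edge of $x$) from the component containing $r(x)$ to the component containing $x$ (a loop if these coincide). Let $Q_F$ be the $(s-1)\times(|V|-1)$ matrix with columns indexed by $V\setminus\{g\}$ and $(Q_F)_{a,v}=1$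 if $v\in C_a(F)$, $0$ otherwise ($1\le a\le s-1$), and $B_F=Q_FD$. For $S\subseteq N$ with $|S|=s-1$, $\chi_F(S)=\det B_F[:,S]$, with $\chi_F(\varnothing)=1$ when $s=1$. *)

(* Defs.v *)
From HB Require Import structures.
From mathcomp Require Import all_boot all_order all_algebra.
Set Implicit Arguments.
Unset Strict Implicit.
Unset Printing Implicit Defensive.
Import GRing.Theory.
Local Open Scope ring_scope.

Record sgraph (V : finType) := SGraph {
  adj :> rel V;
  adj_sym : symmetric adj;
  adj_irr : irreflexive adj }.

Section Graphs.
Variable V : finType.
Implicit Types G F : sgraph V.

Definition connected G : Prop := forall u v : V, connect G u v.

(* A duplicate-free closed walk on two vertices traverses one edge back and
   forth; the cycles of a simple graph are those on at least three vertices. *)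
Definition acyclic G : Prop := forall c : seq V, ucycle G c -> (size c <= 2)%N.

Definition spanning_forest G F : Prop := subrel F G /\ acyclic F.

Definition component F (v : V) : {set V} := [set u | connect F v u].
Definition components F : {set {set V}} := [set component F v | v : V].
Definition ncomp F : nat := #|components F|.

Lemma component_in F v : component F v \in components F.
Proof. exact: imset_f. Qed.

End Graphs.

(* Directed multigraphs with vertices in T and edges labelled by I. *)
Record multigraph (T I : finType) := Multigraph {
  mverts : {set T};
  medges : {set I};
  msrc : I -> T;
  mtgt : I -> T;
  mincP : forall i, i \in medges -> (msrc i \in mverts) && (mtgt i \in mverts) }.

Section SpanningTrees.
Variables (T I : finType) (H : multigraph T I).

Definition joins (i : I) (u v : T) : bool :=
  ((msrc H i == u) && (mtgt H i == v)) || ((msrc H i == v) && (mtgt H i == u)).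

Definition madj (S : {set I}) : rel T :=
  [rel u v | [exists i in S, joins i u v]].

(* A cycle is a cyclic sequence of pairs (vertex, edge leading to the next
   vertex) without repeated vertex or edge; a loop is a cycle of length 1 and
   two parallel edges form a cycle of length 2. *)
Definition mcycle (S : {set I}) (c : seq (T * I)) : Prop :=
  [/\ c != [::], uniq (unzip1 c), uniq (unzip2 c),
      {subset unzip2 c <= S}
    & cycle [rel p q : T * I | joins p.2 p.1 q.1] c].

Definition spanning_tree (S : {set I}) : Prop :=
  [/\ S \subset medges H,
      {in mverts H &, forall u v, connect (madj S) u v}
    & forall c, ~ mcycle S c].

End SpanningTrees.

Record superports (V : finType) := Superports {
  boundary : {set V};
  ports : {set {set V}};
  port_root : {set V} -> V;
  boundary_neq0 : boundary != set0;
  portsP : partition ports boundary;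
  port_rootP : forall A, A \in ports -> port_root A \in A }.

Section Superports.
Variables (V : finType) (P : superports V).

Definition roots : {set V} := [set port_root P A | A in ports P].
Definition nonroots : {set V} := boundary P :\: roots.
Definition root_of (x : V) : V := port_root P (pblock (ports P) x).

Record port_order := PortOrder {
  ground : V;
  ground_root : ground \in roots;
  nonroot_seq : #|nonroots|.-tuple V;
  nonroot_seq_uniq : uniq nonroot_seq;
  nonroot_seqP : nonroot_seq =i nonroots }.

End Superports.

Section Submatrices.
Variables (R : Type).

(* The increasing enumeration of a k-element set of indices (enum lists the
   elements of an ordinal type in increasing order). *)
Definition inc n k (T : {set 'I_n}) (hT : #|T| = k) (j : 'I_k) : 'I_n :=
  enum_val (cast_ord (esym hT) j).

Definition submat m n k l (A : 'M[R]_(m, n)) (S : {set 'I_m}) (T : {set 'I_n})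
    (hS : #|S| = k) (hT : #|T| = l) : 'M[R]_(k, l) :=
  mxsub (inc hS) (inc hT) A.

Definition colsubmat m n l (A : 'M[R]_(m, n)) (T : {set 'I_n})
    (hT : #|T| = l) : 'M[R]_(m, l) :=
  colsub (inc hT) A.

End Submatrices.

Section Quotient.
Variables (R : realFieldType) (V : finType).
Variables (P : superports V) (O : port_order P).

Let g := ground O.
Let q := #|nonroots P|.

(* The coordinates of R^(V \ {g}) are indexed through enum_val; in particular
   the vector attached to g is 0. *)
Definition basis_vec (v : V) : 'cV[R]_#|[set~ g]| :=
  \col_i (enum_val i == v)%:R.

Definition Dmx : 'M[R]_(#|[set~ g]|, q) :=
  \matrix_(i, j) (basis_vec (tnth (nonroot_seq O) j)
                  - basis_vec (root_of P (tnth (nonroot_seq O) j))) i 0.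

Variable F : sgraph V.

(* The components other than the one of g, in some order; the row index
   a : 'I_(ncomp F).-1 stands for the (a + 1)-st of them. *)
Record comp_order := CompOrder {
  other_comps : (ncomp F).-1.-tuple {set V};
  other_comps_uniq : uniq other_comps;
  other_compsP : other_comps =i components F :\ component F g }.

Variable C : comp_order.

Definition Qmx : 'M[R]_((ncomp F).-1, #|[set~ g]|) :=
  \matrix_(a, i) (enum_val i \in tnth (other_comps C) a)%:R.

Definition Bmx : 'M[R]_((ncomp F).-1, q) := Qmx *m Dmx.

Definition positions (S : {set V}) : {set 'I_q} :=
  [set j | tnth (nonroot_seq O) j \in S].

Lemma card_positions (S : {set V}) :
  S \subset nonroots P -> #|positions S| = #|S|.
Proof.
move=> sSN.
have inj : injective (tnth (nonroot_seq O)) by apply/tuple_uniqP; exact: nonroot_seq_uniq.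
rewrite -(card_imset _ inj); apply: eq_card => v.
apply/imsetP/idP => [[j]|vS]; first by rewrite inE => jS ->.
have /tnthP [j vj] : v \in nonroot_seq O by rewrite nonroot_seqP (subsetP sSN).
by exists j; rewrite // inE -vj.
Qed.

Definition chi (S : {set V}) (hSN : S \subset nonroots P)
    (hS : #|S| = (ncomp F).-1) : R :=
  \det (colsubmat Bmx (etrans (card_positions hSN) hS)).

Definition quotient_src (x : V) : {set V} := component F (root_of P x).
Definition quotient_tgt (x : V) : {set V} := component F x.

Lemma quotient_inc x : x \in nonroots P ->
  (quotient_src x \in components F) && (quotient_tgt x \in components F).
Proof. by rewrite !component_in. Qed.

End Quotient.

Definition quotient_graph (V : finType) (P : superports V) (F : sgraph V) :
    multigraph {set V} V :=
  Multigraph (@quotient_inc V P F).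

(* Main.v *)
(**
  The matrix [B_F] is the signed vertex-edge incidence matrix of the quotient
  port multigraph with the row of the component of [g] deleted. A square
  submatrix either has a column with a single nonzero entry, along which its
  determinant expands, or has zero column sums. A vector of the left kernel of
  a maximal minor is a potential on the components that vanishes at the ground
  component and is constant along the selected edges, so the minor is nonzero
  exactly when these edges connect everything; a cycle among them would give a
  nonzero vector in the right kernel.
*)
Require Import Defs.
From HB Require Import structures.
From mathcomp Require Import all_boot all_order all_algebra.
Set Implicit Arguments.
Unset Strict Implicit.
Unset Printing Implicit Defensive.
Import GRing.Theory.
Local Open Scope ring_scope.

(** * Minors of incidence matrices *)

Definition incidence_mx (R : pzRingType) (T : eqType) m n (t : 'I_m -> T)
    (s d : 'I_n -> T) : 'M[R]_(m, n) :=
  \matrix_(a, j) ((d j == t a)%:R - (s j == t a)%:R).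

Lemma sum_eq_codom (R : pzSemiRingType) (T : eqType) m (t : 'I_m -> T) (v : T) :
  injective t -> \sum_a (v == t a)%:R = (v \in codom t)%:R :> R.
Proof.
move=> t_inj; case: codomP => [[a ->]|vNt]; last first.
  by rewrite big1 // => a _; case: eqP => // va; case: vNt; exists a.
rewrite (bigD1 a) //= eqxx big1 ?addr0 // => b.
by rewrite (inj_eq t_inj) eq_sym => /negPf ->.
Qed.

(** Induction on [k]. Endpoints outside the range of [t] are allowed and contribute zero, so
    deleting a row and a column leaves a matrix of the same form. *)
Lemma det_incidence_mx (R : fieldType) (T : eqType) k
    (t s d : 'I_k -> T) : injective t ->
  \det (incidence_mx R t s d) \in [:: 0; 1; -1].
Proof.
elim: k t s d => [|k IHk] t s d t_inj; first by rewrite det_mx00 !inE eqxx orbT.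
have [bal|/existsP[j unbal]] :=
    boolP [forall j, (d j \in codom t) == (s j \in codom t)].
  (* Each column has both ends or neither among the rows, so the all-ones vector lies in the left
     kernel. *)
  suff -> : \det (incidence_mx R t s d) = 0 by rewrite inE eqxx.
  apply/eqP/det0P; exists (const_mx 1).
    apply/eqP => /matrixP/(_ 0 0); rewrite !mxE => /eqP; apply/negP.
    exact: oner_neq0.
  apply/rowP => j; rewrite !mxE.
  under eq_bigr do rewrite !mxE mul1r.
  by rewrite sumrB !sum_eq_codom // (eqP (forallP bal j)) subrr.
(* Exactly one end of edge [j] is a row, so column [j] is a unit vector up to sign. *)
have [a [e]] : exists a, exists e : bool, forall b,
    incidence_mx R t s d b j = (-1) ^+ e * (b == a)%:R.
  have notin v : v \notin codom t -> forall b, (v == t b) = false.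
    by move=> vNt b; apply: contraNF vNt => /eqP ->; apply: codom_f.
  move: unbal; case: codomP => [[a da]|dt].
    case: (boolP (s j \in codom t)) => // sNt _.
    have st := notin _ sNt; exists a, false => b.
    by rewrite !mxE st da (inj_eq t_inj) eq_sym subr0 expr0 mul1r.
  have {}dt : d j \notin codom t by apply/codomP.
  case: codomP => [[a sa]|//] _; exists a, true => b.
  by rewrite !mxE (notin _ dt) sa (inj_eq t_inj) eq_sym sub0r expr1 mulN1r.
move=> colj; rewrite (expand_det_col _ j) (bigD1 a) //= big1 ?addr0; last first.
  by move=> b /negPf ba; rewrite colj ba mulr0 mul0r.
rewrite colj eqxx mulr1 /cofactor mulrA -exprD.
have -> : row' a (col' j (incidence_mx R t s d))
    = incidence_mx R (t \o lift a) (s \o lift j) (d \o lift j).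
  by apply/matrixP => x y; rewrite !mxE.
have := IHk (t \o lift a) (s \o lift j) (d \o lift j) (inj_comp t_inj lift_inj).
rewrite !inE -signr_odd; case: odd; rewrite (expr1, expr0) ?mul1r // mulN1r.
by rewrite oppr_eq0 eqr_oppLR eqr_opp orbA orbAC -orbA.
Qed.

(** * Maximal minors and spanning trees *)

Section SpanningTreeMinor.
Variables (R : fieldType) (T I : finType) (H : multigraph T I) (S : {set I}).
Variables (m : nat) (r : T) (t : 'I_m -> T) (f : 'I_m -> I).
Hypotheses (SH : S \subset medges H) (rH : r \in mverts H).
Hypotheses (t_inj : injective t) (tE : forall v, (v \in codom t) = (v \in mverts H :\ r)).
Hypotheses (f_inj : injective f) (fE : forall i, (i \in codom f) = (i \in S)).

Let M := incidence_mx R t (msrc H \o f) (mtgt H \o f).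

Lemma madj_sym : connect_sym (madj H S).
Proof.
by apply: sym_connect_sym => u v; apply: eq_existsb => i; rewrite /joins orbC.
Qed.

Lemma mem_f j : f j \in S. Proof. by rewrite -fE codom_f. Qed.

Lemma f_surj i : i \in S -> exists j, i = f j.
Proof. by rewrite -fE => /codomP. Qed.

(** The extension of [y] by zero from the rows to all of [T]. Left multiplication by [y] then gives
    the potential difference along each selected edge. *)
Definition potential (y : 'rV[R]_m) (v : T) := \sum_a y 0 a * (v == t a)%:R.

Lemma potential_row y a : potential y (t a) = y 0 a.
Proof.
rewrite /potential (bigD1 a) //= eqxx mulr1 big1 ?addr0 // => b.
by rewrite (inj_eq t_inj) eq_sym => /negPf ->; rewrite mulr0.
Qed.

Lemma potential_ground y : potential y r = 0.
Proof.
apply: big1 => a _; case: eqP => [ra|_]; last by rewrite mulr0.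
by have := codom_f t a; rewrite tE -ra !inE eqxx.
Qed.

Lemma mul_row_incidence y j :
  (y *m M) 0 j = potential y (mtgt H (f j)) - potential y (msrc H (f j)).
Proof.
by rewrite !mxE -sumrB; apply: eq_bigr => a _; rewrite !mxE mulrBr.
Qed.

Lemma connected_det_neq0 :
  {in mverts H &, forall u v, connect (madj H S) u v} -> \det M != 0.
Proof.
move=> conn; apply/negP => /det0P[y /eqP y0 yM]; apply: y0.
have edge u v : madj H S u v -> potential y u = potential y v.
  move=> /existsP[i /andP[/f_surj[j ->] /orP[]]] /andP[/eqP <- /eqP <-];
    have := mul_row_incidence y j; rewrite yM mxE => /esym/eqP;
    by rewrite subr_eq0 => /eqP.
have const u v : connect (madj H S) u v -> potential y u = potential y v.
  move=> /connectP[p + ->]; elim: p u => //= w p IHp u /andP[/edge -> ].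
  exact: IHp.
apply/rowP => a; rewrite !mxE -potential_row (const _ r) ?potential_ground //.
by apply: conn => //; have := codom_f t a; rewrite tE inE => /andP[].
Qed.

Lemma det_neq0_connected :
  \det M != 0 -> {in mverts H &, forall u v, connect (madj H S) u v}.
Proof.
move=> detM.
suff conn v : v \in mverts H -> connect (madj H S) r v.
  by move=> u v /conn ru /conn; apply: connect_trans; rewrite madj_sym.
move=> vH; apply: contraNT detM => rNv; apply/det0P.
(* The indicator of the vertices not reached from [r] is constant along the edges of [S], vanishes
   at [r] and equals 1 at [v]. *)
pose y : 'rV[R]_m := \row_a (~~ connect (madj H S) r (t a))%:R.
have yE w : w \in mverts H -> potential y w = (~~ connect (madj H S) r w)%:R.
  move=> wH; have [->|wr] := eqVneq w r; first by rewrite potential_ground connect0.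
  have /codomP[a ->] : w \in codom t by rewrite tE !inE wr.
  by rewrite potential_row mxE.
exists y.
  apply/eqP => y0; have := yE v vH; rewrite rNv y0 /potential big1 => [/esym/eqP|a _].
    by rewrite oner_eq0.
  by rewrite mxE mul0r.
apply/rowP => j; rewrite mul_row_incidence mxE.
have /mincP/andP[sH dH] := subsetP SH _ (mem_f j).
rewrite !yE // (_ : connect _ r (mtgt H (f j)) = connect (madj H S) r (msrc H (f j))).
  by rewrite subrr.
apply/esym/(same_connect_r madj_sym)/connect1/existsP; exists (f j).
by rewrite mem_f /joins !eqxx.
Qed.

Lemma det_neq0_acyclic (c : seq (T * I)) : \det M != 0 -> ~ mcycle H S c.
Proof.
move=> detM [+ _ + cS]; case: c cS => // p c cS _ /= /andP[pNc _] cyc.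
suff : \det M == 0 by rewrite (negPf detM).
rewrite -det_tr; apply/det0P.
(* The direction in which the cycle traverses an edge. A loop gets sign 1, which is harmless since
   its column is zero. *)
pose sg (x : T * I) : R := if msrc H x.2 == x.1 then 1 else -1.
pose z : 'rV[R]_m := \row_j \sum_(x <- p :: c | x.2 == f j) sg x.
exists z.
  (* The first edge of the cycle does not recur, so its entry in [z] is a single sign. *)
  have /f_surj[j pj] : p.2 \in S by apply: cS; rewrite inE eqxx.
  apply/eqP => /rowP/(_ j); rewrite !mxE big_cons pj eqxx big1_seq => [/eqP|x].
    by rewrite addr0 /sg; case: ifP; rewrite ?oppr_eq0 oner_eq0.
  move=> /andP[/eqP xj xc]; case/negP: pNc; rewrite pj -xj; exact: map_f.
apply/rowP => a; rewrite !mxE.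
pose phi i : R := (mtgt H i == t a)%:R - (msrc H i == t a)%:R.
transitivity (\sum_(x <- p :: c) sg x * phi x.2).
  (* Exchange the sums: as [f] is injective, each step of the cycle meets exactly one column. *)
  under eq_bigr do rewrite !mxE mulr_suml.
  rewrite (exchange_big_dep xpredT) //= big_seq [RHS]big_seq; apply: eq_bigr => x xc.
  have /f_surj[j xj] : x.2 \in S by apply: cS; apply: map_f.
  rewrite (big_pred1 j) ?xj // => i /=.
  by rewrite (inj_eq f_inj) eq_sym.
pose F (x : T * I) : R := (x.1 == t a)%:R.
(* The signed column of a step is a difference of vertex indicators, so the sum telescopes to zero
   around the cycle. *)
have step (x y : T * I) : joins H x.2 x.1 y.1 -> sg x * phi x.2 = F y - F x.
  rewrite /sg /phi /F => /orP[] /andP[/eqP Hs /eqP Ht]; rewrite Hs Ht.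
    by rewrite eqxx mul1r.
  by case: eqP => [->|_]; rewrite ?subrr ?mulr0 // mulN1r opprB.
have telescope x q : path [rel x y : T * I | joins H x.2 x.1 y.1] x q ->
    \sum_(w <- belast x q) sg w * phi w.2 = F (last x q) - F x.
  elim: q x => [|w q IHq] x /=; first by rewrite big_nil subrr.
  by move=> /andP[/step xw /IHq qE]; rewrite big_cons xw qE addrC subrKA.
by move: (telescope p _ cyc); rewrite belast_rcons last_rcons subrr.
Qed.

Lemma det_neq0_spanning_tree : \det M != 0 <-> spanning_tree H S.
Proof.
split=> [detM|[_ conn _]]; last exact: connected_det_neq0.
split=> //; first exact: det_neq0_connected.
by move=> c; apply: det_neq0_acyclic.
Qed.

End SpanningTreeMinor.

(** * The quotient matrix as an incidence matrix *)

Lemma inc_inj n k (A : {set 'I_n}) (hA : #|A| = k) : injective (inc hA).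
Proof. by move=> i j /enum_val_inj /cast_ord_inj. Qed.

Lemma codom_inc n k (A : {set 'I_n}) (hA : #|A| = k) i :
  (i \in codom (inc hA)) = (i \in A).
Proof.
apply/codomP/idP => [[j ->]|iA]; first exact: enum_valP.
exists (cast_ord hA (enum_rank_in iA i)).
by rewrite /inc cast_ordK enum_rankK_in.
Qed.

Lemma component_eq {V : finType} (F : sgraph V) (u v : V) :
  (component F u == component F v) = (u \in component F v).
Proof.
have Fsym : connect_sym F by apply/sym_connect_sym/adj_sym.
rewrite inE; apply/eqP/idP => [/setP/(_ u)|vu]; first by rewrite !inE connect0.
by apply/setP => w; rewrite !inE (same_connect Fsym vu).
Qed.

Section QuotientIncidence.
Variables (R : realFieldType) (V : finType) (P : superports V).
Variables (O : port_order P) (F : sgraph V) (C : comp_order O F).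

Lemma other_comps_inj : injective (tnth (other_comps C)).
Proof. by apply/tuple_uniqP; apply: other_comps_uniq. Qed.

Lemma other_comps_component a v :
  (v \in tnth (other_comps C) a) = (component F v == tnth (other_comps C) a).
Proof.
have := mem_tnth a (other_comps C); rewrite other_compsP => /setD1P[_ /imsetP[u _ ->]].
by rewrite component_eq.
Qed.

Lemma Bmx_incidence : Bmx R C = incidence_mx R (tnth (other_comps C))
  (fun j => component F (root_of P (tnth (nonroot_seq O) j)))
  (fun j => component F (tnth (nonroot_seq O) j)).
Proof.
apply/matrixP => a j; rewrite !mxE -!other_comps_component.
set A := tnth _ a.
have gNA : ground O \notin A.
  have := mem_tnth a (other_comps C); rewrite other_compsP => /setD1P[Ag _].
  by rewrite other_comps_component eq_sym.
(* At the ground both sides vanish: its basis vector is zero, and [A] is not the ground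
   component. *)
have coord x : \sum_i (enum_val i \in A)%:R * basis_vec R O x i 0 = (x \in A)%:R.
  under eq_bigr do rewrite mxE.
  rewrite -(big_enum_val (fun v => (v \in A)%:R * (v == x)%:R)) /=.
  have [xg|xg] := eqVneq x (ground O).
    rewrite xg (negPf gNA) big1 // => v; rewrite !inE => /negPf ->.
    by rewrite mulr0.
  rewrite (bigD1 x) ?inE //= eqxx mulr1 big1 ?addr0 // => v /andP[_ /negPf ->].
  by rewrite mulr0.
rewrite -!coord -sumrB; apply: eq_bigr => i _.
by rewrite !mxE mulrBr.
Qed.

End QuotientIncidence.

Theorem lemma3p2 (R : realFieldType) (V : finType) (G : sgraph V)
    (hG : connected G) (P : superports V) (O : port_order P)
    (F : sgraph V) (hF : spanning_forest G F) (C : comp_order O F) :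
  (forall (k : nat) (S : {set 'I_(ncomp F).-1}) (T : {set 'I_#|nonroots P|})
          (hS : #|S| = k) (hT : #|T| = k),
     \det (submat (Bmx R C) hS hT) \in [:: 0; 1; -1])
  /\
  (forall (S : {set V}) (hSN : S \subset nonroots P)
          (hS : #|S| = (ncomp F).-1),
     chi R C hSN hS \in [:: 0; 1; -1]
     /\ (chi R C hSN hS <> 0 <-> spanning_tree (quotient_graph P F) S)).
Proof.
(* Selecting rows and columns amounts to composing the vertex and edge labels with [p] and [h]. *)
have minorE k (p : 'I_k -> 'I_(ncomp F).-1) (h : 'I_k -> 'I_#|nonroots P|) :
    mxsub p h (Bmx R C) = incidence_mx R (tnth (other_comps C) \o p)
      (quotient_src P F \o (tnth (nonroot_seq O) \o h))
      (quotient_tgt F \o (tnth (nonroot_seq O) \o h)).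
  by rewrite Bmx_incidence; apply/matrixP => a j; rewrite !mxE.
split=> [k S T hS hT|S hSN hS].
  rewrite /submat minorE; apply: det_incidence_mx.
  exact: inj_comp (@other_comps_inj _ _ _ _ C) (@inc_inj _ _ _ hS).
rewrite /chi /colsubmat; set hc := etrans _ _; rewrite minorE; split.
  by apply: det_incidence_mx; apply: other_comps_inj.
have nr_inj : injective (tnth (nonroot_seq O)).
  by apply/tuple_uniqP; apply: nonroot_seq_uniq.
have tE A : (A \in codom (tnth (other_comps C))) =
    (A \in mverts (quotient_graph P F) :\ component F (ground O)).
  by rewrite -(other_compsP C); apply/codomP/tnthP.
(* The selected columns, read through the order on the nonroots, list exactly the edges of [S]. *)
have fE v : (v \in codom (tnth (nonroot_seq O) \o inc hc)) = (v \in S).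
  apply/codomP/idP => [[j ->]|vS].
    by have := codom_f (inc hc) j; rewrite codom_inc inE.
  have /tnthP[j vj] : v \in nonroot_seq O by rewrite nonroot_seqP (subsetP hSN).
  have /codomP[i ji] : j \in codom (inc hc) by rewrite codom_inc inE -vj.
  by exists i; rewrite /= -ji.
apply: (iff_trans _ (@det_neq0_spanning_tree R _ _ (quotient_graph P F) S _ _ _ _
  hSN (component_in F _) (@other_comps_inj _ _ _ _ C) tE
  (inj_comp nr_inj (@inc_inj _ _ _ hc)) fE)).
by split=> /eqP.
Qed.
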